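(* For every integer $n\ge1$, the following algorithm outputs $D(n)$, the number of repeated cubes (occurrences of cubes) in $\mathbb{T}[1,n]$. Start with the vector $$v=[\underbrace{0,\ldots,0}_{57},1,\underbrace{0,\ldots,0}_{48},1,1,\underbrace{0,\ldots,0}_{30},1,\underbrace{0,\ldots,0}_{37}]$$ of length $176$. If $n\le176$, output the sum of the first $n$ entries of $v$. If $n\ge177$, let $M$ be the positive integer with $2t_{M-1}<n\le2t_M$ (so $M\ge8$). For $m=8,9,\ldots,M$ successively, replace $v$ by the concatenation of $v$ with the vector of length $t_m$ $$[v(\Theta_{m-3}),v(\Theta_{m-2}),v(\Theta_{m-1})]+[\underbrace{0,\ldots,0}_{\frac{-t_{m-1}+5t_{m-3}+1}{2}},\underbrace{1,\ldots,1}_{\frac{t_{m-1}-3t_{m-3}-1}{2}},\underbrace{0,\ldots,0}_{t_{m-1}+t_{m-2}}].$$ After the step $m=M$, output the sum of the first $n$ entries of $v$.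
   Context: The Tribonacci substitution $\sigma$ on the alphabet $\{a,b,c\}$ is $\sigma(a)=ab$, $\sigma(b)=ac$, $\sigma(c)=a$. The Tribonacci sequence $\mathbb{T}$ is the infinite word that is the fixed point of $\sigma$ beginning with $a$; $\mathbb{T}[1,n]$ is its prefix of length $n$. Put $T_{-2}=\epsilon$ (empty word), $T_{-1}=c$, $T_m=\sigma^m(a)$ for $m\ge0$, $t_m=|T_m|$ for $m\ge-2$, and $t_{-3}=0$; thus $t_{-3}=t_{-2}=0$, $t_{-1}=t_0=1$, $t_1=2$, $t_2=4$, $t_3=7$, $t_4=13$, and $t_m=t_{m-1}+t_{m-2}+t_{m-3}$ for $m\ge1$. For a non-empty factor $\omega$ of $\mathbb{T}$ and $p\ge1$, $\omega_p$ is the position in $\mathbb{T}$ of the last letter of the $p$-th occurrence of $\omega$. Write $\nu\triangleright\omega$ if $\nu$ is a suffix of $\omega$. Then $D(n)=\#\{(\omega,p)\mid \omega \text{ non-empty},\ p\ge1,\ \omega\omega\omega\triangleright\mathbb{T}[1,\omega_{p+2}],\ \omega_{p+2}\le n\}$. For $m\ge0$, $\Theta_m$ is the interval of $t_m$ consecutive integers $\{i+\frac{t_{m+1}+t_{m-1}-3}{2} : 1\le i\le t_m\}$ (these intervals partition the positive integers). For an interval $I=\{i,i+1,\ldots,j\}$, $v(I)=[v[i],v[i+1],\ldots,v[j]]$ where $v[k]$ is the $k$-th entry of $v$; $[x,y,z]$ for vectors denotes concatenation. Vectors of equal length are added entrywise; the number under a brace is the number of repeated entries. *)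

(* Defs.v *)
From HB Require Import structures.
From mathcomp Require Import all_boot all_algebra finmap.
From mathcomp Require Import boolp classical_sets functions cardinality.

Set Implicit Arguments.
Unset Strict Implicit.
Unset Printing Implicit Defensive.

Local Open Scope nat_scope.

Inductive letter := La | Lb | Lc.

Definition letter_code (x : letter) : 'I_3 :=
  match x with La => inord 0 | Lb => inord 1 | Lc => inord 2 end.
Definition letter_decode (i : 'I_3) : letter :=
  match val i with 0 => La | 1 => Lb | _ => Lc end.
Lemma letter_codeK : cancel letter_code letter_decode.
Proof. by case; rewrite /letter_decode /= inordK. Qed.
HB.instance Definition _ := Countable.copy letter (can_type letter_codeK).

Definition sigma_letter (x : letter) : seq letter :=
  match x with La => [:: La; Lb] | Lb => [:: La; Lc] | Lc => [:: La] end.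
Definition sigma (w : seq letter) : seq letter := flatten (map sigma_letter w).

(* An infinite word is indexed from 0, so [T i] is the letter at position
   [i + 1] in the usual 1-based numbering. *)
Definition word_prefix (T : nat -> letter) (n : nat) : seq letter := mkseq T n.

(* sigma(T) = T: every sigma(T[1,n]) is a prefix of T; this determines the whole
   infinite word sigma(T) because sigma erases no letter. *)
Definition sigma_fixed (T : nat -> letter) : Prop :=
  forall n, sigma (word_prefix T n) =
            word_prefix T (size (sigma (word_prefix T n))).

Definition is_tribonacci (T : nat -> letter) : Prop :=
  sigma_fixed T /\ T 0 = La.

Lemma tribonacci_exists : exists T, is_tribonacci T.
Proof.
pose W m := iter m sigma [:: La].
have sigma_cat u v : sigma (u ++ v) = sigma u ++ sigma v.
  by rewrite /sigma map_cat flatten_cat.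
have step m : exists2 x, 0 < size x & W m.+1 = W m ++ x.
  elim: m => [|m [x x0 e]]; first by exists [:: Lb].
  exists (sigma x); last by rewrite -[LHS]/(sigma (W m.+1)) {1}e sigma_cat.
  by case: x x0 {e} => [|[] x].
have szW m : m < size (W m).
  elim: m => [|m IH] //; have [x x0 ->] := step m.
  by rewrite size_cat -addn1 leq_add.
have ext m k : exists x, W (m + k) = W m ++ x.
  elim: k => [|k [x e]]; first by exists [::]; rewrite addn0 cats0.
  have [y _ e'] := step (m + k).
  by exists (x ++ y); rewrite addnS e' e catA.
have nthW i m m' : i < size (W m) -> i < size (W m') ->
    nth La (W m) i = nth La (W m') i.
  wlog le_mm' : m m' / m <= m' => [H|].
    by case/orP: (leq_total m m') => le hm hm'; [|apply/esym]; apply: H.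
  by have [x] := ext m (m' - m); rewrite subnKC // => -> hm _; rewrite nth_cat hm.
pose T i := nth La (W i) i.
have preT n m : n <= size (W m) -> word_prefix T n = take n (W m).
  move=> le_n; apply: (@eq_from_nth _ La); rewrite size_mkseq ?size_takel //.
  move=> i lt_i; rewrite nth_mkseq // nth_take //; apply: nthW => //.
  exact: leq_trans le_n.
exists T; split=> // n.
rewrite (preT n n); last exact: ltnW.
have eW : W n.+1 = sigma (take n (W n)) ++ sigma (drop n (W n)).
  by rewrite -sigma_cat cat_take_drop.
rewrite (preT _ n.+1); last by rewrite eW size_cat leq_addr.
by rewrite eW take_size_cat.
Qed.

Definition is_factor (T : nat -> letter) (w : seq letter) : Prop :=
  exists n, infix w (word_prefix T n).

(* [occ_pos T w p k]: the p-th occurrence of [w] in [T] ends at (1-based)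
   position [k]. Occurrences may overlap. *)
Definition occ_pos (T : nat -> letter) (w : seq letter) (p k : nat) : Prop :=
  suffix w (word_prefix T k) /\
  count (fun j => suffix w (word_prefix T j)) (iota 1 k) = p.

Definition cube_pairs (T : nat -> letter) (n : nat) : set (seq letter * nat) :=
  [set wp | let: (w, p) := wp in
    [/\ w <> [::], is_factor T w, 1 <= p &
      exists k, [/\ occ_pos T w p.+2 k,
                    suffix (w ++ w ++ w) (word_prefix T k) & k <= n]]]%classic.

(* [fset_set] sends an infinite set to the empty one, so this is the number of
   pairs only when [cube_pairs T n] is finite. *)
Definition D (T : nat -> letter) (n : nat) : nat :=
  #|` fset_set (cube_pairs T n)|%fset.

(* T_m = sigma^m(a) for m >= 0, T_{-1} = c, and the empty word below. *)
Definition trib_word (m : int) : seq letter :=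
  match m with
  | Posz k => iter k sigma [:: La]
  | Negz 0 => [:: Lc]
  | Negz _ => [::]
  end.

Definition t (m : int) : nat := size (trib_word m).

(* In [Theta] and [increment] the subtractions and halvings are exact for the
   indices in use (m >= 0, resp. m >= 8). *)
Definition Theta (m : nat) : seq nat :=
  [seq i + (t (m%:Z + 1) + t (m%:Z - 1) - 3) %/ 2 | i <- iota 1 (t m%:Z)].

(* Vector entries are numbered from 1. *)
Definition entry (v : seq nat) (k : nat) : nat := nth 0 v k.-1.

Definition entries_on (v : seq nat) (I : seq nat) : seq nat :=
  [seq entry v k | k <- I].

Definition vec_add (u v : seq nat) : seq nat :=
  [seq xy.1 + xy.2 | xy <- zip u v].

Definition v_init : seq nat :=
  nseq 57 0 ++ [:: 1] ++ nseq 48 0 ++ [:: 1; 1] ++ nseq 30 0 ++ [:: 1] ++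
  nseq 37 0.

Definition increment (m : nat) : seq nat :=
  nseq ((5 * t (m%:Z - 3) + 1 - t (m%:Z - 1)) %/ 2) 0 ++
  nseq ((t (m%:Z - 1) - 3 * t (m%:Z - 3) - 1) %/ 2) 1 ++
  nseq (t (m%:Z - 1) + t (m%:Z - 2)) 0.

Definition extend (v : seq nat) (m : nat) : seq nat :=
  v ++ vec_add
         (entries_on v (Theta (m - 3)) ++ entries_on v (Theta (m - 2)) ++
          entries_on v (Theta (m - 1)))
         (increment m).

Definition run (M : nat) : seq nat := foldl extend v_init (index_iota 8 M.+1).

(* [algorithm n r]: on input [n] the algorithm outputs [r]. *)
Inductive algorithm (n : nat) : nat -> Prop :=
| algorithm_short : n <= 176 -> algorithm n (sumn (take n v_init))
| algorithm_long (M : nat) : 177 <= n -> 0 < M ->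
    2 * t (M%:Z - 1) < n <= 2 * t M%:Z ->
    algorithm n (sumn (take n (run M))).

(* Main.v *)
(* Each block sigma(x) starts with its only a, so the blocks of T = sigma(T) are
   delimited by the letters a. Hence a maximal run of matches T[i] = T[i + p] is
   the image of a maximal run in T with a shorter period, followed by one more
   a; iterating, every run descends from an empty run at two positions x < x'.
   After g steps its length is W_g = t_0 + ... + t_(g-1) and its period is
   |sigma^g(T[x..x'-1])|, and twice the period fits in W_g only if
   T[x..x'-1] = c. So the cubes are exactly those inside the runs of period
   t_(g-1) that start where sigma^g(T[x]) does, for a letter T[x] = c.

   The prefix of length W_(m+1) has period t_m, so the cubes ending at k and at
   k - t_m correspond for k in Theta_m = (W_m, W_(m+1)], except for the cubes
   starting in the first period; these all lie in the run coming from the first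
   c of T, with g = m - 2, and produce the block of ones in the increment. *)
Require Import Defs.
From mathcomp Require Import all_boot all_algebra finmap zify.
From mathcomp Require Import boolp classical_sets functions cardinality.

Set Implicit Arguments.
Unset Strict Implicit.
Unset Printing Implicit Defensive.

Local Open Scope nat_scope.

(** * Lengths of the iterated images of letters *)

Lemma sigma_cat u v : sigma (u ++ v) = sigma u ++ sigma v.
Proof. by rewrite /sigma map_cat flatten_cat. Qed.

Lemma iter_sigma_cat g u v :
  iter g sigma (u ++ v) = iter g sigma u ++ iter g sigma v.
Proof. by elim: g => //= g ->; rewrite sigma_cat. Qed.

(** In terms of t these lengths are t_g for a, t_(g-1) + t_(g-2) for b and t_(g-1) for c. *)
Definition len (g : nat) (x : letter) : nat := size (iter g sigma [:: x]).

Lemma lenSa g : len g.+1 La = len g La + len g Lb.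
Proof. by rewrite /len iterSr (iter_sigma_cat g [:: La] [:: Lb]) size_cat. Qed.

Lemma lenSb g : len g.+1 Lb = len g La + len g Lc.
Proof. by rewrite /len iterSr (iter_sigma_cat g [:: La] [:: Lc]) size_cat. Qed.

Lemma lenSc g : len g.+1 Lc = len g La.
Proof. by rewrite /len iterSr. Qed.

Definition lenE := (lenSa, lenSb, lenSc).

Lemma len_gt0 g x : 0 < len g x.
Proof.
suff: [/\ 0 < len g La, 0 < len g Lb & 0 < len g Lc] by case: x => -[].
by elim: g => // g [? ? ?]; rewrite !lenE; split; lia.
Qed.

Lemma len_le g : len g Lc <= len g Lb <= len g La.
Proof. by elim: g => // g IH; rewrite !lenE; lia. Qed.

(* W m = (t_(m+1) + t_(m-1) - 3) / 2, so that Theta_m is the interval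
   (W m, W m.+1]. *)
Fixpoint W (g : nat) : nat := if g is h.+1 then len h La + W h else 0.

Lemma WS g : W g.+1 = len g La + W g. Proof. by []. Qed.

Lemma W_closed g : 2 * W g + 3 = len g La + len g Lb + len g Lc.
Proof. by elim: g => // g IH; rewrite !lenE WS; lia. Qed.

(** The first bound makes [W g] smaller than twice any period containing sigma^g(b); its induction
    step needs the second bound. *)
Lemma W_lt g : W g < 2 * len g Lb /\ W g < len g La + 2 * len g Lc.
Proof.
by elim: g => // g IH; have := len_le g; rewrite !lenE WS; lia.
Qed.

Lemma len_le_W g : len g La <= (W g).+1.
Proof. by elim: g => // g IH; have := len_le g; rewrite !lenE WS; lia. Qed.

Lemma leq_len g h : g <= h -> len g La <= len h La.
Proof.
move=> /subnK <-; elim: (h - g) => // k IH.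
by apply: leq_trans IH _; rewrite addSn lenE leq_addr.
Qed.

Lemma leq_W g h : g <= h -> W g <= W h.
Proof.
move=> /subnK <-; elim: (h - g) => // k IH.
by apply: leq_trans IH _; rewrite addSn WS leq_addl.
Qed.

(** * Block structure of T *)

Section TribonacciWord.

Variable T : nat -> letter.
Hypothesis hT : is_tribonacci T.

(* The block sigma(T[n]) of T = sigma(T) starts at position [cut n], and
   sigma^g(T[n]) at [iter g cut n]. *)
Definition cut (n : nat) : nat := size (sigma (mkseq T n)).

Lemma mkseqSr n : mkseq T n.+1 = mkseq T n ++ [:: T n].
Proof. by rewrite /mkseq -addn1 iotaD map_cat. Qed.

Lemma cut0 : cut 0 = 0. Proof. by []. Qed.

Lemma iter_sigma_prefix g n : iter g sigma (mkseq T n) = mkseq T (iter g cut n).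
Proof. by elim: g => //= g ->; case: hT => fT _; exact: fT. Qed.

Lemma iter_cutS g n : iter g cut n.+1 = iter g cut n + len g (T n).
Proof.
have E m : iter g cut m = size (iter g sigma (mkseq T m)).
  by rewrite iter_sigma_prefix size_mkseq.
by rewrite !E mkseqSr iter_sigma_cat size_cat.
Qed.

Lemma cutS n : cut n.+1 = cut n + len 1 (T n).
Proof. exact: (iter_cutS 1 n). Qed.

Lemma iter_cut0 g : iter g cut 0 = 0.
Proof. by elim: g => //= g ->. Qed.

Lemma block_letter g n j : j < len g (T n) ->
  T (iter g cut n + j) = nth La (iter g sigma [:: T n]) j.
Proof.
move=> lt_j; have /(congr1 (fun s => nth La s (iter g cut n + j))) :=
  iter_sigma_prefix g n.+1.
rewrite mkseqSr iter_sigma_cat iter_sigma_prefix nth_cat size_mkseq.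
rewrite ltnNge leq_addr addKn iter_cutS /= => ->.
by rewrite nth_mkseq // ltn_add2l.
Qed.

Lemma T_cut n : T (cut n) = La.
Proof.
have := @block_letter 1 n 0 (len_gt0 _ _); rewrite addn0 => ->.
by case: (T n).
Qed.

Lemma len1_le2 x : 1 <= len 1 x <= 2. Proof. by case: x. Qed.

(** The block of c is a single letter, so there the a of the next block is read. Since a -> b -> c
    -> a is a bijection, this letter determines [T n]. *)
Lemma T_cut1 n : T (cut n).+1 =
  match T n with La => Lb | Lb => Lc | Lc => La end.
Proof.
case E: (T n).
- by have := @block_letter 1 n 1; rewrite addn1 E; apply.
- by have := @block_letter 1 n 1; rewrite addn1 E; apply.
by have := cutS n; rewrite E addn1 => <-; exact: T_cut.
Qed.

(** The same bijection gives the last letter of a block; through it left maximality passes to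
    preimages. *)
Lemma T_cut_pred n : T (cut n.+1).-1 =
  match T n with La => Lb | Lb => Lc | Lc => La end.
Proof.
rewrite (cutS n); case E: (T n).
- by rewrite addn2 T_cut1 E.
- by rewrite addn2 T_cut1 E.
by rewrite addn1 T_cut.
Qed.

Lemma cut_mono m n : m < n -> cut m < cut n.
Proof.
elim: n => // n IH; rewrite ltnS leq_eqVlt => le_mn.
have := len_gt0 1 (T n); rewrite (cutS n).
by case/orP: le_mn => [/eqP->|/IH]; lia.
Qed.

Lemma iter_cut_mono g a b : a <= b -> iter g cut a <= iter g cut b.
Proof.
elim: g => // g IH /IH /=.
by rewrite leq_eqVlt => /orP[/eqP->|/cut_mono/ltnW].
Qed.

Lemma cut_cover i : exists n, cut n <= i < cut n.+1.
Proof.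
elim: i => [|i [n /andP[le_n lt_n]]].
  by exists 0; rewrite cut0 (cutS 0) len_gt0.
have [lt|ge] := ltnP i.+1 (cut n.+1).
  by exists n; rewrite lt (leq_trans le_n).
by exists n.+1; rewrite ge (leq_ltn_trans lt_n) // cut_mono.
Qed.

Lemma T_eq_a i : T i = La -> exists n, i = cut n.
Proof.
have [n /andP[le_n lt_n]] := cut_cover i => Ti.
have [E|ne] := eqVneq i (cut n); first by exists n.
exists n.+1; move: Ti; have {ne lt_n le_n}-> : i = (cut n).+1.
  by move: lt_n; rewrite (cutS n); have := len1_le2 (T n); lia.
by rewrite T_cut1 (cutS n); case: (T n) => // _; rewrite addn1.
Qed.

(** The letters b and c occur only as second letters of blocks. *)
Lemma T_pred i : T i <> La -> 0 < i /\ T i.-1 = La.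
Proof.
have [n /andP[le_n lt_n]] := cut_cover i => Ti.
have E : i = (cut n).+1.
  have [E|ne] := eqVneq i (cut n); first by rewrite E T_cut in Ti.
  by move: lt_n; rewrite (cutS n); have := len1_le2 (T n); lia.
by rewrite E T_cut.
Qed.

(** * Runs of matches and their preimages *)

(** For [y = x + p] this says that the L + p letters from position x on have period p. *)
Definition agree x y L := forall i, i < L -> T (x + i) = T (y + i).

(** Both [T (cut x)] and [T (cut y)] are a, so sigma^g(a) stands at both places; the induction
    hypothesis continues from [(cut x).+1] and [(cut y).+1]. *)
Lemma agree_iter_cut g x y : agree (iter g cut x) (iter g cut y) (W g).
Proof.
elim: g x y => // g IH x y i; rewrite WS => lt_i.
rewrite !iterSr; have [lt|ge] := ltnP i (len g La).
  by rewrite !block_letter ?T_cut.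
have lt' : i - len g La < W g by lia.
have := IH (cut x).+1 (cut y).+1 _ lt'.
by rewrite !iter_cutS !T_cut -!addnA subnKC.
Qed.

(** The map [(cut y).+1] sends the end of a run to the end of its image, which includes one more
    a. *)
Lemma iterE g x : iter g (fun y => (cut y).+1) x = iter g cut x + W g.
Proof.
elim: g x => [|g IH] x; first by rewrite addn0.
by rewrite iterSr IH iter_cutS iterSr T_cut WS addnA.
Qed.

(** Induction on L: matches going beyond the image of the L0 letters and one more a identify a
    further letter of the preimages. The last clause keeps the blocks of both copies aligned. *)
Lemma desubst_run x y L : 0 < L -> agree (cut x) (cut y) L ->
  exists L0, [/\ L0 < L, agree x y L0,
    cut x + L <= (cut (x + L0)).+1 &
    cut (x + L0) + cut y = cut x + cut (y + L0)].
Proof.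
elim: L => // -[_ _ _|L IH _ ag].
  by exists 0; rewrite !addn0; split => //; lia.
have {IH}[//|i lt|L0 [ltL ag0 le e]] := IH; first by apply: ag; lia.
have [le'|gt] := leqP (cut x + L.+2) (cut (x + L0)).+1.
  by exists L0; split => //; lia.
(* Match number [L.+1] falls right after a block start in both copies, where [T_cut1] is injective
   in the letter. *)
have eT : T (x + L0) = T (y + L0).
  have := ag L.+1 (ltnSn _).
  have -> : cut x + L.+1 = (cut (x + L0)).+1 by lia.
  have -> : cut y + L.+1 = (cut (y + L0)).+1 by lia.
  by rewrite !T_cut1; case: (T (x + L0)); case: (T (y + L0)).
exists L0.+1; split; first by lia.
- by move=> i; rewrite ltnS leq_eqVlt => /orP[/eqP->|/ag0].
- rewrite (addnS x L0) (cutS (x + L0)) /=.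
  by have := len_gt0 1 (T (x + L0)); lia.
rewrite (addnS x L0) (addnS y L0) (cutS (x + L0)) (cutS (y + L0)) -eT /=.
by lia.
Qed.

Definition left_maximal s s' := s = 0 \/ T s.-1 <> T s'.-1.

(** A nonempty left-maximal run starts at block starts in both copies, so it has a shorter, again
    left-maximal, preimage; the descent stops at an empty run. *)
Lemma run_ancestor L s s' : s < s' -> agree s s' L -> left_maximal s s' ->
  exists g x x', [/\ x < x', s = iter g cut x, s' = iter g cut x'
    & s + L <= iter g cut x + W g].
Proof.
elim/ltn_ind: L s s' => L IH s s' lt ag lm.
have [L0|Lpos] := posnP L.
  by exists 0, s, s'; split => //; rewrite L0.
have Tss : T s = T s' by have := ag 0 Lpos; rewrite !addn0.
(* A common first letter b or c would be preceded by a in both copies, against left maximality. *)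
have Ts : T s = La.
  case: (pselect (T s = La)) => // nT.
  have [s_gt0 Ts] := T_pred nT.
  rewrite Tss in nT; have [_ Ts'] := T_pred nT.
  by case: lm => [s0|]; [lia|rewrite Ts Ts'].
have [x ex] := T_eq_a Ts; rewrite Tss in Ts; have [x' ex'] := T_eq_a Ts.
subst s s'; have lx : x < x'.
  by rewrite ltnNge; apply/negP; rewrite leq_eqVlt => /orP[/eqP ee|/cut_mono];
    [rewrite ee in lt|]; lia.
have [L0 [ltL ag0 le _]] := desubst_run Lpos ag.
have lmx : left_maximal x x'.
  case: x lm lx {ag Tss lt le ag0} => [|x] lm lx; first by left.
  right; case: x' lx lm {Ts} => // x' lx; rewrite /left_maximal !T_cut_pred.
  case=> [|neq eT]; last by apply: neq; move: eT => /= ->.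
  by have := cut_mono (ltn0Sn x); rewrite cut0; lia.
have [g [z [z' [lz e e' le']]]] := IH _ ltL _ _ lx ag0 lmx.
exists g.+1, z, z'; split; rewrite // ?iterS -?e -?e' //.
have E : (cut (x + W g)).+1 = cut x + W g.+1.
  by rewrite e -(iterE g z) -[LHS]/(iter g.+1 (fun y => (cut y).+1) z) iterE.
rewrite -E; apply: leq_trans le _; rewrite ltnS -e in le' *.
by move: le'; rewrite leq_eqVlt => /orP[/eqP->|/cut_mono/ltnW].
Qed.

Lemma left_maximal_extension p j L : agree j (j + p) L ->
  exists s, [/\ s <= j, agree s (s + p) (j - s + L) & left_maximal s (s + p)].
Proof.
elim: j L => [|j IH] L ag; first by exists 0; split => //; left.
have [eT|nT] := pselect (T j = T (j + p)); last first.
  by exists j.+1; split; rewrite ?subnn //; right; rewrite addSn.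
have [|s [le ag' lm]] := IH L.+1.
  move=> [|i] lt; first by rewrite !addn0.
  by rewrite !addnS; apply: (ag i).
by exists s; split => //; [apply: leqW|rewrite subSn // addSnnS].
Qed.

(** * Cubes inside runs *)

(** Boolean, so that cubes can be counted. The root is given by its length p only; k is the 1-based
    end position, hence the 0-based position just after the cube. *)
Definition cube k p := [&& 0 < p, 3 * p <= k &
  all (fun i => T (k - 3 * p + i) == T (k - 2 * p + i)) (iota 0 (2 * p))].

Lemma cube_agree k p : reflect
  [/\ 0 < p, 3 * p <= k & agree (k - 3 * p) (k - 3 * p + p) (2 * p)] (cube k p).
Proof.
apply: (iffP and3P) => -[p0 le ag]; split=> //.
  move=> i lt; have /allP/(_ i) := ag; rewrite mem_iota => /(_ lt)/eqP->.
  by congr T; lia.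
apply/allP => i; rewrite mem_iota => lt; apply/eqP; rewrite (ag i lt).
by congr T; lia.
Qed.

(* Every long run descends from a run started by a single c, because a period
   containing an a or a b is too long for [W g]. *)
Lemma cubeP k p : cube k p <-> exists g x,
  [/\ T x = Lc, p = len g Lc, 3 * p <= k, iter g cut x <= k - 3 * p
    & k - p <= iter g cut x + W g].
Proof.
split=> [/cube_agree[p0 le ag]|[g [x [Tx ep le lb ub]]]].
  have [s [le_s {}ag lm]] := left_maximal_extension ag.
  have lt_s : s < s + p by lia.
  have [g [x [x' [lx es es' lW]]]] := run_ancestor lt_s ag lm.
  have lW2 : 2 * p <= W g by lia.
  have := iter_cut_mono g lx; rewrite iter_cutS => lT.
  have := W_lt g; have := len_le g => leg [ltg1 ltg2].
  have Tx : T x = Lc by case E: (T x) lT => // lT; lia.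
  exists g, x; have ex' : x' = x.+1.
    apply/eqP; rewrite eqn_leq lx andbT leqNgt; apply/negP => lt.
    have := iter_cut_mono g lt; rewrite !iter_cutS Tx.
    case Tx1: (T x.+1) => Tx2; try lia.
    (* Only [T x.+1 = Lc] is left, but c is always preceded by a, so cc does not occur. *)
    have : T x.+1 <> La by rewrite Tx1.
    by move=> /T_pred[_]; rewrite /= Tx.
  move: es'; rewrite ex' iter_cutS Tx => es'; split => //; lia.
have p0 : 0 < p by rewrite ep len_gt0.
apply/cube_agree; split => // i lt.
have lt' : k - 3 * p - iter g cut x + i < W g by lia.
have := @agree_iter_cut g x x.+1 _ lt'; rewrite iter_cutS Tx -ep => E.
have -> : k - 3 * p + i = iter g cut x + (k - 3 * p - iter g cut x + i) by lia.
by rewrite E; congr T; lia.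
Qed.

(** * Cubes starting in the first period *)

Lemma T_start j : j < 7 -> T j = nth La [:: La; Lb; La; Lc; La; Lb; La] j.
Proof.
move=> lt; have T0 : T 0 = La by case: hT.
by have := @block_letter 3 0 j; rewrite iter_cut0 T0; apply.
Qed.

Lemma iter_cut3 g : iter g cut 3 = len g.+1 La + len g La.
Proof. by rewrite !iter_cutS iter_cut0 !T_start // lenE /=. Qed.

Lemma iter_cut7 g : iter g cut 7 = len g.+3 La.
Proof. by rewrite !iter_cutS iter_cut0 !T_start // !lenE /=; lia. Qed.

Lemma c_position x : T x = Lc -> x = 3 \/ 7 <= x.
Proof.
have [|] := ltnP x 7; last by right.
move=> lt Tx; left; move: Tx; rewrite T_start //.
by case: x lt => [|[|[|[|[|[|[|x]]]]]]].
Qed.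

(* End positions of the cubes of period t_n in the run that comes from the first
   c of T, at position 3, after n + 1 steps. *)
Definition new_range n k :=
  len n.+1 La + len n.+2 La + 3 * len n La <= k <= W n.+3 + len n La.

(** Starting before t_(n+3) forces a generation of at most n + 1. Cubes from the first c with a
    smaller generation, and all cubes from later c's, end too early to reach beyond [W n.+3]. *)
Lemma new_cubeP n k p : W n.+3 < k <= W n.+4 -> k - 3 * p < len n.+3 La ->
  cube k p = (p == len n La) && new_range n k.
Proof.
move=> /andP[lb ub] lt_s; apply/idP/andP.
  move=> /cubeP[[|h] [x [Tx ep le xs xe]]].
    (* In generation 0 the run is empty and contains no cube. *)
    by have {}ep : p = 1 by []; subst p; move: xs xe => /=; lia.
  rewrite lenSc in ep.
  have x3 : 3 <= x by case: (c_position Tx); lia.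
  have := iter_cut_mono h.+1 x3; rewrite iter_cut3 => s3.
  have le_h : h <= n.
    by rewrite leqNgt; apply/negP => /(@leq_len n.+3 h.+2); lia.
  case: (c_position Tx) => [ex|/(iter_cut_mono h.+1)].
    rewrite ex iter_cut3 WS in xs xe; have [lt_h|ge_h] := ltnP h n.
      have := @leq_W h.+3 n.+2 lt_h; have := @leq_len h n.+2.
      by move: lb; rewrite !WS; lia.
    have eh : h = n by lia.
    subst h; rewrite -ep eqxx /new_range; split=> //.
    by move: lb; rewrite !WS; lia.
  rewrite iter_cut7 => s7.
  have lt_h : h.+2 <= n.
    by rewrite leqNgt; apply/negP => /(@leq_len n.+3 h.+4); lia.
  have := @leq_W h.+2 n lt_h; have := len_le_W h; have := len_gt0 h Lb.
  by move: lb lt_s; rewrite !WS !lenE; lia.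
case=> /eqP-> /andP[lb' ub']; apply/cubeP; exists n.+1, 3.
rewrite iter_cut3 lenSc T_start //.
have := len_gt0 n La; have := W_lt n; have := len_le n.
by move: lb' ub'; rewrite !WS; split=> //; lia.
Qed.

(** * Translation of cubes by t_m *)

(** The runs from positions 0 and 1, whose m-th images start at 0 and t_m. *)
Lemma periodic_prefix m : agree 0 (len m La) (W m).
Proof.
have T0 : T 0 = La by case: hT.
by have := @agree_iter_cut m 0 1; rewrite iter_cutS iter_cut0 T0.
Qed.

Lemma cube_shift m k p : 0 < k -> k <= W m -> cube (len m La + k) p ->
  3 * p <= k -> cube k p.
Proof.
move=> k0 le /cube_agree[p0 _ ag] lep; apply/cube_agree; split=> // i lt.
have := ag i lt; rewrite -addnBA // -!addnA -!periodic_prefix ?add0n //; lia.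
Qed.

Lemma cube_shift_back m k p : k <= W m -> cube k p -> cube (len m La + k) p.
Proof.
move=> le /cube_agree[p0 lep ag]; apply/cube_agree; split=> //; first by lia.
move=> i lt; have := ag i lt.
rewrite -addnBA // -!addnA -!periodic_prefix ?add0n //; lia.
Qed.

(** If 3p <= k, the cube ending at t_(n+3) + k starts after the first period and can be translated;
    otherwise no cube of period p ends at k, and [new_cubeP] applies. *)
Lemma cube_recurrence n k p : W n < k <= W n.+3 ->
  (cube (len n.+3 La + k) p : nat) =
  cube k p + ((p == len n La) && new_range n (len n.+3 La + k)).
Proof.
move=> /andP[lb ub]; have [le|gt] := leqP (3 * p) k.
  (* A new cube with 3p <= k would give 2 t_n <= [W n], against [W_lt]. *)
  have -> : (p == len n La) && new_range n (len n.+3 La + k) = false.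
    apply/negP => /andP[/eqP ep /andP[_]]; rewrite !WS ep !lenE in le lb *.
    have := W_lt n; have := len_le n; lia.
  rewrite addn0; congr nat_of_bool; apply/idP/idP.
    by move/cube_shift; apply=> //; lia.
  exact: cube_shift_back.
rewrite (@new_cubeP n).
- by rewrite /cube (leqNgt (3 * p)) gt andbF.
- by move: lb ub; rewrite !WS !lenE; lia.
by have := len_gt0 n.+3 La; lia.
Qed.

(** * Number of cubes by end position *)

Definition cubes_ending k := count (cube k) (iota 1 k).

Lemma count_cube_widen k N : k <= N ->
  count (cube k) (iota 1 N) = cubes_ending k.
Proof.
move=> le; rewrite /cubes_ending -(subnKC le) iotaD count_cat.
rewrite [X in _ + X](_ : _ = 0) ?addn0 //.
apply/eqP; rewrite -leqn0 leqNgt -has_count; apply/hasPn => p.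
by rewrite mem_iota /cube => lp; apply/negP => /and3P[? ? _]; lia.
Qed.

Lemma cubes_ending_recurrence n k : W n < k <= W n.+3 ->
  cubes_ending (len n.+3 La + k) =
  cubes_ending k + new_range n (len n.+3 La + k).
Proof.
move=> range; set K := len n.+3 La + k.
rewrite -(@count_cube_widen k K) ?leq_addl // /cubes_ending -!sumn_count.
rewrite !sumnE !big_map.
under eq_bigr do rewrite cube_recurrence //.
rewrite big_split /=; congr (_ + _).
have le : len n La <= K by rewrite /K !lenE; lia.
case: (new_range _ _); last by rewrite big1 // => p _; rewrite andbF.
under eq_bigr do rewrite andbT.
have p0 := len_gt0 n La.
rewrite (bigD1_seq (len n La)) ?iota_uniq ?mem_iota //=; last by lia.
by rewrite eqxx big1 // => p /negbTE->.
Qed.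

(** The first c is at position 3, so nonempty runs start at 6 or later and a cube ends at 9 or
    later, while [W 3] is 7. *)
Lemma cubes_ending_small k : k <= W 3 -> cubes_ending k = 0.
Proof.
move=> le; apply/eqP; rewrite -leqn0 leqNgt -has_count; apply/hasPn => p _.
apply/negP => /cubeP[[|h] [x [Tx ep lep xs xe]]].
  by have {}ep : p = 1 by []; subst p; move: xs xe => /=; lia.
have x3 : 3 <= x by case: (c_position Tx); lia.
have := iter_cut_mono h.+1 x3; rewrite iter_cut3.
have : 1 <= len h La := len_gt0 h La.
have : 2 <= len h.+1 La := @leq_len 1 h.+1 isT.
have : 4 <= len h.+2 La := @leq_len 2 h.+2 isT.
by have : k <= 7 := le; rewrite lenSc in ep; lia.
Qed.

(** * The vectors of the algorithm *)

Definition cube_vector n := [seq cubes_ending k | k <- iota 1 n].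

Lemma t_pos m : t m%:Z = len m La. Proof. by []. Qed.

Lemma t_pred m : t (m%:Z - 1) = len m Lc.
Proof. by case: m => // m; rewrite lenSc -t_pos; congr t; lia. Qed.

Lemma ThetaE m : Theta m = [seq W m + i | i <- iota 1 (len m La)].
Proof.
rewrite /Theta t_pred (_ : (m%:Z + 1)%R = m.+1); last by lia.
rewrite !t_pos lenE -W_closed addnK mulKn //.
by apply: eq_map => i; rewrite addnC.
Qed.

Lemma entries_cube_vector m n : W m.+1 <= n ->
  entries_on (cube_vector n) (Theta m) =
  [seq cubes_ending (W m + i) | i <- iota 1 (len m La)].
Proof.
rewrite WS => le; rewrite /entries_on ThetaE -map_comp; apply/eq_in_map => i.
rewrite mem_iota /= /entry => lt.
rewrite (nth_map 0) ?size_iota ?nth_iota; try lia.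
by congr cubes_ending; lia.
Qed.

(** [W_closed] makes the halvings exact; [W_lt] and [len_le_W] prevent truncation in the
    subtractions. *)
Lemma incrementE n : increment n.+3 =
  nseq (2 * len n La - W n - 1) 0 ++ nseq (W n + 1 - len n La) 1 ++
  nseq (len n.+2 La + len n.+1 La) 0.
Proof.
have t3 : t (n.+3%:Z - 3) = len n La by rewrite -t_pos; congr t; lia.
have t2 : t (n.+3%:Z - 2) = len n.+1 La by rewrite -t_pos; congr t; lia.
rewrite /increment t_pred t3 t2 lenSc.
have := W_closed n; have [ltW _] := W_lt n; have := len_le_W n.
by rewrite !lenE => leW E; congr (nseq _ _ ++ (nseq _ _ ++ _)); lia.
Qed.

Lemma size_increment n : size (increment n.+3) = len n.+3 La.
Proof.
rewrite incrementE !size_cat !size_nseq.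
have := W_lt n; have := len_le n; have := len_le_W n; rewrite !lenE; lia.
Qed.

(** Counted from [W n.+3], [new_range] goes from 2 t_n - W_n to t_n, as does the block of ones. *)
Lemma increment_entry n i : i < len n.+3 La ->
  nth 0 (increment n.+3) i = new_range n (W n.+3 + i.+1).
Proof.
rewrite incrementE /new_range => lt_i.
have [ltW _] := W_lt n; have := len_le n; have := len_le_W n.
rewrite !WS !lenE in lt_i * => le1 le2.
rewrite nth_cat size_nseq nth_nseq; case: ltnP => lt1; first by lia.
rewrite nth_cat size_nseq !nth_nseq if_same; case: ltnP => lt2; apply/esym/eqP.
  by rewrite eqb1; apply/andP; split; lia.
by rewrite eqb0; apply/negP => /andP[? ?]; lia.
Qed.

Lemma map_iota_cat (A : Type) (f : nat -> A) a c d :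
  [seq f (a + i) | i <- iota 1 c] ++ [seq f (c + a + i) | i <- iota 1 d] =
  [seq f (a + i) | i <- iota 1 (c + d)].
Proof.
rewrite iotaD map_cat (addnC 1 c) iotaDl -map_comp; congr (_ ++ _).
by apply: eq_map => i /=; rewrite addnCA addnA.
Qed.

(* The three copied intervals are consecutive: together they are the translate
   of Theta_(n+3) by - t_(n+3). *)
Lemma extend_cube_vector n :
  extend (cube_vector (W n.+3)) n.+3 = cube_vector (W n.+4).
Proof.
have cvE m : cube_vector m = [seq cubes_ending (0 + i) | i <- iota 1 m] by [].
have [e3 e2 e1] : [/\ n.+3 - 3 = n, n.+3 - 2 = n.+1 & n.+3 - 1 = n.+2].
  by split; lia.
rewrite /extend e3 e2 e1.
rewrite !entries_cube_vector; try by apply: leq_W; lia.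
rewrite [W n.+4]WS addnC [RHS]cvE -map_iota_cat; congr (_ ++ _).
rewrite [W n.+2]WS [W n.+1]WS map_iota_cat map_iota_cat.
have -> : len n La + (len n.+1 La + len n.+2 La) = len n.+3 La.
  by rewrite !lenE; lia.
have size_zip : size (zip
    [seq cubes_ending (W n + i) | i <- iota 1 (len n.+3 La)] (increment n.+3)) =
  len n.+3 La.
  by rewrite size1_zip size_map size_iota ?size_increment.
apply: (@eq_from_nth _ 0); first by rewrite !size_map size_iota size_zip.
move=> i; rewrite size_map size_zip => lt_i.
transitivity (cubes_ending (W n + i.+1) + new_range n (W n.+3 + i.+1)).
  rewrite (nth_map (0, 0)) ?size_zip // nth_zip; last first.
    by rewrite size_map size_iota size_increment.
  by rewrite increment_entry // (nth_map 0) ?size_iota // nth_iota.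
have EK : W n.+3 + i.+1 = len n.+3 La + (W n + i.+1) by rewrite !WS !lenE; lia.
rewrite EK -cubes_ending_recurrence; last by move: lt_i; rewrite !WS !lenE; lia.
by rewrite -EK (nth_map 0) ?size_iota // nth_iota // addn0.
Qed.

(* [v_init] is itself obtained from seven zeros by the steps m = 3, ..., 7. *)
Lemma run_cube_vector M : 7 <= M -> run M = cube_vector (W M.+1).
Proof.
have E3 : nseq 7 0 = cube_vector (W 3).
  apply: (@eq_from_nth _ 0); first by rewrite size_map size_iota.
  move=> i; rewrite size_nseq nth_nseq if_same => lt.
  rewrite (nth_map 0) ?size_iota // nth_iota //.
  by rewrite cubes_ending_small.
have E8 : v_init = cube_vector (W 8).
  rewrite -!extend_cube_vector -E3; vm_compute; reflexivity.
rewrite /run /index_iota E8 => /subnKC <-; move: (M - 7) => k.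
rewrite (_ : (7 + k).+1 - 8 = k); last by lia.
elim: k => // k IH.
rewrite -[in LHS](addn1 k) iotaD foldl_cat IH.
exact: (extend_cube_vector (5 + k)).
Qed.

(** * From cubes to pairs of a word and an occurrence number *)

Lemma nth_cat_addr (A : Type) (x : A) u v j :
  nth x (u ++ v) (size u + j) = nth x v j.
Proof. by rewrite nth_cat ltnNge leq_addr addKn. Qed.

Lemma suffix_prefixE (w : seq letter) k :
  suffix w (mkseq T k) = (drop (k - size w) (mkseq T k) == w).
Proof. by rewrite suffixE size_mkseq. Qed.

Lemma suffix_prefixP (w : seq letter) k : reflect
  (size w <= k /\ forall i, i < size w -> T (k - size w + i) = nth La w i)
  (suffix w (mkseq T k)).
Proof.
rewrite suffix_prefixE; apply: (iffP eqP) => [e|[le E]].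
  have le : size w <= k by rewrite -e size_drop size_mkseq leq_subr.
  split=> // i lt; rewrite -[in RHS]e nth_drop nth_mkseq //; lia.
apply: (@eq_from_nth _ La) => [|i]; rewrite size_drop size_mkseq subKn //.
by move=> lt; rewrite nth_drop nth_mkseq ?E //; lia.
Qed.

Lemma cube_suffixP (w : seq letter) k : w <> [::] ->
  suffix (w ++ w ++ w) (mkseq T k) <->
  cube k (size w) /\ suffix w (mkseq T k).
Proof.
move=> w0; have p0 : 0 < size w by case: w w0.
have sz : size (w ++ w ++ w) = 3 * size w by rewrite !size_cat; lia.
split=> [sf|[/cube_agree[_ le ag] /suffix_prefixP[_ E]]].
  split; last by apply: suffix_trans sf; rewrite catA suffix_suffix.
  have [] := suffix_prefixP _ _ sf; rewrite sz => le E.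
  apply/cube_agree; split=> // i lt; rewrite -addnA !E; try lia.
  rewrite nth_cat_addr catA nth_cat size_cat.
  by have -> : i < size w + size w by lia.
apply/suffix_prefixP; rewrite sz; split=> // i lt.
have last_w j : j < size w ->
    T (k - 3 * size w + (size w + size w + j)) = nth La w j.
  by move=> lt_j; rewrite -E //; congr T; lia.
have mid_w j : j < size w -> T (k - 3 * size w + (size w + j)) = nth La w j.
  by move=> lt_j; rewrite ag -?last_w //; [congr T|]; lia.
rewrite !nth_cat; case: ltnP => lt1.
  by rewrite ag -?mid_w //; [congr T|]; lia.
case: ltnP => lt2; first by rewrite -mid_w //; congr T; lia.
by rewrite -last_w; [congr T|]; lia.
Qed.

Definition occ_count (w : seq letter) k :=
  count (fun j => suffix w (word_prefix T j)) (iota 1 k).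

Lemma occ_count_lt w k k' : k < k' -> suffix w (mkseq T k') ->
  occ_count w k < occ_count w k'.
Proof.
move=> lt sf; rewrite /occ_count -(subnKC (ltnW lt)) iotaD count_cat.
rewrite -[X in X < _]addn0 ltn_add2l -has_count; apply/hasP; exists k' => //.
by rewrite mem_iota; lia.
Qed.

(** The three copies of w are distinct occurrences, so subtracting 2 leaves an index of at least
    1. *)
Lemma occ_count_cube (w : seq letter) k :
  w <> [::] -> suffix (w ++ w ++ w) (mkseq T k) -> 2 < occ_count w k.
Proof.
move=> w0 sf; have p0 : 0 < size w by case: w w0 {sf}.
have sfw := (iffLR (cube_suffixP k w0) sf).2.
have [] := suffix_prefixP _ _ sf; rewrite !size_cat => le E.
have sf1 : suffix w (mkseq T (k - size w)).
  apply/suffix_prefixP; split=> [|i lt]; first by lia.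
  have := E (size w + i); rewrite nth_cat_addr nth_cat lt => <-;
    [congr T|]; lia.
have sf2 : suffix w (mkseq T (k - size w - size w)).
  apply/suffix_prefixP; split=> [|i lt]; first by lia.
  have := E i; rewrite nth_cat lt => <-; [congr T|]; lia.
have := @occ_count_lt w 0 _ _ sf2; have := occ_count_lt _ sf1.
have := occ_count_lt _ sfw.
move=> /(_ (k - size w)) h1 /(_ (k - size w - size w)) h2 h3.
by have := h1 ltac:(lia); have := h2 ltac:(lia); have := h3 ltac:(lia); lia.
Qed.

Definition root k p := drop (k - p) (mkseq T k).

Lemma size_root k p : p <= k -> size (root k p) = p.
Proof. by move=> le; rewrite size_drop size_mkseq subKn. Qed.

Lemma suffix_root k p : suffix (root k p) (mkseq T k).
Proof. exact: suffix_drop. Qed.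

Definition cube_list n :=
  [seq (k, p) | k <- iota 1 n, p <- [seq p <- iota 1 k | cube k p]].

Lemma mem_cube_list n k p :
  ((k, p) \in cube_list n) = (k <= n) && cube k p.
Proof.
apply/allpairsPdep/andP => [[k' [p' [k'n]]]|[le cb]].
  rewrite mem_filter mem_iota in k'n * => /andP[cb _] [-> ->].
  by split=> //; lia.
have [p0 lep _] := and3P cb.
by exists k, p; rewrite mem_filter !mem_iota cb; split=> //; lia.
Qed.

Definition cube_pair (kp : nat * nat) : seq letter * nat :=
  (root kp.1 kp.2, occ_count (root kp.1 kp.2) kp.1 - 2).

(** The word is the root at the end position k, and p + 2 counts its occurrences up to k; so the
    pairs form a finite list. *)
Lemma cube_pairsE n :
  cube_pairs T n = [set` [seq cube_pair kp | kp <- cube_list n]]%classic.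
Proof.
apply/seteqP; split=> [[w p] /= [w0 _ p0 [k [[sfw cnt] sf le]]]|[w p] /=].
  have [cb _] := iffLR (cube_suffixP k w0) sf.
  have [lew _] := suffix_prefixP _ _ sfw.
  have ew : root k (size w) = w.
    by apply/eqP; rewrite -suffix_prefixE.
  apply/mapP; exists (k, size w); first by rewrite mem_cube_list le.
  by rewrite /cube_pair /= ew /occ_count cnt subn2.
move=> /mapP[[k q]]; rewrite mem_cube_list => /andP[le cb] [-> ->].
have [q0 leq _] := and3P cb; have szq : size (root k q) = q.
  by rewrite size_root //; lia.
have w0 : root k q <> [::] by move=> e; move: szq q0; rewrite e => <-.
have sf : suffix (root k q ++ root k q ++ root k q) (mkseq T k).
  by apply/(cube_suffixP k w0); rewrite szq suffix_root.
have gt2 := occ_count_cube w0 sf.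
split=> //=; [by exists k; apply: suffixW; exact: suffix_root|lia|].
exists k; split=> //; split; first exact: suffix_root.
by rewrite -/(occ_count _ _) /=; lia.
Qed.

(** Equal roots have equal lengths, and [occ_count] increases strictly from one occurrence of the
    root to the next. *)
Lemma cube_pair_inj n : {in cube_list n &, injective cube_pair}.
Proof.
move=> [k q] [k' q']; rewrite !mem_cube_list => /andP[_ cb] /andP[_ cb'] [].
have [q0 leq _] := and3P cb; have [q0' leq' _] := and3P cb'.
move=> ew; have eq : q = q'.
  by move: (congr1 size ew); rewrite !size_root //; lia.
subst q'; rewrite -ew => ecnt; congr pair.
(* Both counts exceed 2, so the truncated subtraction can be cancelled. *)
have big j : cube j q -> root j q = root k q -> 2 < occ_count (root k q) j.
  move=> cbj ej; have szq : size (root k q) = q by rewrite size_root //; lia.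
  have w0 : root k q <> [::] by move=> e; move: szq q0; rewrite e => <-.
  apply: (occ_count_cube w0); apply/(cube_suffixP j w0).
  by rewrite szq -{1}ej suffix_root.
have b := big _ cb erefl; have b' := big _ cb' (esym ew).
case: (ltngtP k k') => // lt.
  have := @occ_count_lt (root k q) _ _ lt; rewrite {1}ew suffix_root.
  by move=> /(_ isT); lia.
by have := @occ_count_lt (root k q) _ _ lt (suffix_root _ _); lia.
Qed.

Lemma uniq_cube_list n : uniq (cube_list n).
Proof.
apply: allpairs_uniq_dep => [|k _|]; rewrite ?filter_uniq ?iota_uniq //.
by move=> [k p] [k' p'] _ _ [-> ->].
Qed.

Lemma size_cube_list n : size (cube_list n) = sumn (cube_vector n).
Proof.
by rewrite size_allpairs_dep; congr sumn; apply: eq_map => k;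
  rewrite size_filter.
Qed.

Lemma D_cube_vector n : D T n = sumn (cube_vector n).
Proof.
rewrite /D cube_pairsE -size_cube_list -(size_map cube_pair).
set s := map _ _.
have -> : [set` s]%classic = [set` [fset x in s]%fset]%classic.
  by apply/seteqP; split=> x /=; rewrite inE.
rewrite set_fsetK card_fseq undup_id // map_inj_in_uniq ?uniq_cube_list //.
exact: cube_pair_inj.
Qed.

(** * Output of the algorithm *)

Lemma sumn_take_cube_vector n N : n <= N ->
  sumn (take n (cube_vector N)) = sumn (cube_vector n).
Proof. by move=> le; rewrite -map_take take_iota (minn_idPl le). Qed.

Lemma sumn_run M n : 176 < n -> n <= 2 * t M%:Z ->
  sumn (take n (run M)) = sumn (cube_vector n).
Proof.
(* A smaller M would give n <= 162, since t_7 = 81. *)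
rewrite t_pos => gt le; have leM : 7 <= M.
  rewrite leqNgt; apply/negP => /ltnW/leq_len.
  by rewrite -[len 7 La]/81; lia.
rewrite run_cube_vector // sumn_take_cube_vector // WS.
(* Here [W M] is t_M + W_(M-3), so the vector, of length t_M + W_M, has at least 2 t_M entries. *)
have : len M La <= W M; last by lia.
by rewrite -(subnK (leq_trans (isT : 3 <= 7) leM)) addn3 !WS !lenE; lia.
Qed.

(** For n > 176 the least M with n <= 2 t_M also satisfies the strict lower bound, by minimality. *)
Lemma algorithm_cube_vector n : algorithm n (sumn (cube_vector n)).
Proof.
have [le|gt] := leqP n 176.
  rewrite -(sumn_take_cube_vector (N := W 8)) //.
  by rewrite -run_cube_vector //; exact: algorithm_short.
have ex : exists M, n <= 2 * len M La.
  exists n; suff : n <= len n La by lia.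
  elim: (n) => // k IH; rewrite lenSa; have := len_gt0 k Lb; lia.
case: (ex_minnP ex) => -[|M] leM minM; first by move: (leM : n <= 2); lia.
rewrite -(@sumn_run M.+1) //; apply: algorithm_long => //.
by rewrite t_pred lenSc leM andbT ltnNge; apply/negP => /minM; rewrite ltnn.
Qed.

Lemma algorithm_unique n r : algorithm n r -> r = sumn (cube_vector n).
Proof.
case=> [le|M gt _ /andP[_ le]]; last exact: sumn_run.
(* [run 7] performs no step, so it is the initial vector. *)
by rewrite -[v_init]/(run 7) run_cube_vector // sumn_take_cube_vector.
Qed.

End TribonacciWord.

Theorem mainTheorem4 (T : nat -> letter) (hT : is_tribonacci T)
    (n : nat) (hn : 1 <= n) :
  finite_set (cube_pairs T n) /\
  (forall r : nat, algorithm n r <-> r = D T n).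
Proof.
split; first by rewrite cube_pairsE; exact: finite_seq.
move=> r; rewrite D_cube_vector //; split=> [/(algorithm_unique hT)//|->].
exact: algorithm_cube_vector.
Qed.
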